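(* For all partitions $\lambda,\mu$, the polynomial $\widetilde\Phi^{(\beta-r+s)}_{\lambda+\boldsymbol\delta_r,\mu+\boldsymbol\delta_s}(y)$ depends only on $\beta,\lambda,\mu$ and not on $r,s$, as long as $r,s\in\mathbb N$ satisfy $r\ge\ell(\lambda)$ and $s\ge\ell(\mu)$.
   Context: A partition is a weakly decreasing sequence $\lambda=(\lambda_1,\lambda_2,\dots)$ of nonnegative integers, eventually zero; $|\lambda|=\sum\lambda_i$, $\ell(\lambda)$ is the number of nonzero parts. $\boldsymbol\delta_r=(r-1,r-2,\dots,1,0)$ and, for $r\ge\ell(\lambda)$, $\lambda+\boldsymbol\delta_r=(\lambda_1+r-1,\lambda_2+r-2,\dots,\lambda_r)$. $(z)_m=\prod_{j=0}^{m-1}(z+j)$. Monic Laguerre polynomials: $\widehat L_n^{(\beta)}(y)=\sum_{i=0}^n(-1)^{n+i}\binom ni(\beta+i+1)_{n-i}y^i$; $\psi_\pm^{(\beta)}(n,x)=e^{-x^2/2}x^{\frac12\pm\beta}\widehat L_n^{(\pm\beta)}(x^2)$. For strictly decreasing tuples $\boldsymbol m=(m_1,\dots,m_r)$, $\boldsymbol n=(n_1,\dots,n_s)$ of nonnegative integers, $\Psi^{(\beta)}_{\boldsymbol m,\boldsymbol n}(x)$ is the Wronskian in $x$ of $\psi_+^{(\beta)}(m_1,x),\dots,\psi_+^{(\beta)}(m_r,x),\psi_-^{(\beta)}(n_1,x),\dots,\psi_-^{(\beta)}(n_s,x)$; $\Delta(\boldsymbol v)=\prod_{i<j}(v_j-v_i)$;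 $\kappa^{(\beta)}_{\boldsymbol m,\boldsymbol n}=\Delta(2\boldsymbol m+\beta,2\boldsymbol n-\beta)$. $\widetilde\Phi^{(\beta)}_{\boldsymbol m,\boldsymbol n}(y)\in\mathbb Z[\beta,y]$ is the polynomial, monic in $y$, such that $\Psi^{(\beta)}_{\boldsymbol m,\boldsymbol n}(x)=\kappa^{(\beta)}_{\boldsymbol m,\boldsymbol n}e^{-\frac12(r+s)x^2}x^{\frac12(r-s)^2+\beta(r-s)}\widetilde\Phi^{(\beta)}_{\boldsymbol m,\boldsymbol n}(x^2)$ identically in $\beta,x$ (its existence and uniqueness are known). *)

(* Defs.v *)
From HB Require Import structures.
From mathcomp Require Import all_boot all_order all_algebra.
From mathcomp Require Import all_classical all_reals all_analysis.
Set Implicit Arguments. Unset Strict Implicit. Unset Printing Implicit Defensive.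
Import Order.TTheory GRing.Theory Num.Theory.
Import numFieldNormedType.Exports.
Local Open Scope ring_scope.

(* Partitions: weakly decreasing sequences of positive integers (the nonzero
   parts); lambda_i = nth 0 lam (i-1); ell(lam) = size lam. *)
Definition is_partition (lam : seq nat) : bool :=
  sorted geq lam && all (fun k => 0 < k)%N lam.

(* lam + delta_r = (lam_1 + r - 1, ..., lam_r + 0), for r >= ell(lam). *)
Definition add_delta (lam : seq nat) (r : nat) : seq nat :=
  [seq (nth 0 lam i + (r - i.+1))%N | i <- iota 0 r].

Section Real.
Variable R : realType.

Definition rising (z : R) (m : nat) : R := \prod_(j < m) (z + j%:R).

Definition laguerre_hat (n : nat) (b y : R) : R :=
  \sum_(i < n.+1) (-1) ^+ (n + i) * 'C(n, i)%:R * rising (b + i%:R + 1) (n - i) * y ^+ i.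

Definition psi_plus (b : R) (n : nat) (x : R) : R :=
  expR (- (x ^+ 2) / 2) * powR x (2^-1 + b) * laguerre_hat n b (x ^+ 2).
Definition psi_minus (b : R) (n : nat) (x : R) : R :=
  expR (- (x ^+ 2) / 2) * powR x (2^-1 - b) * laguerre_hat n (- b) (x ^+ 2).

Definition wronskian (fs : seq (R -> R)) (x : R) : R :=
  \det (\matrix_(i < size fs, j < size fs) derive1n i (nth (fun _ => 0) fs j) x).

Definition Psi (b : R) (m n : seq nat) : R -> R :=
  wronskian ([seq psi_plus b k | k <- m] ++ [seq psi_minus b k | k <- n]).

Definition vandermonde (v : seq R) : R :=
  \prod_(j < size v) \prod_(i < size v | (i < j)%N) (v`_j - v`_i).

Definition kappa (b : R) (m n : seq nat) : R :=
  vandermonde ([seq 2 * k%:R + b | k <- m] ++ [seq 2 * k%:R - b | k <- n]).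

Definition eval2 (P : {poly {poly int}}) (b y : R) : R :=
  (map_poly (fun c : {poly int} => (map_poly intr c).[b]) P).[y].

Definition is_Phi_tilde (m n : seq nat) (P : {poly {poly int}}) : Prop :=
  lead_coef P = 1 /\
  forall (b x : R), 0 < x ->
    Psi b m n x =
      kappa b m n * expR (- ((size m + size n)%:R * x ^+ 2) / 2)
      * powR x ((((size m)%:Z - (size n)%:Z) ^+ 2)%:~R / 2
                + b * ((size m)%:Z - (size n)%:Z)%:~R)
      * eval2 P b (x ^+ 2).
End Real.

Definition shift_beta (c : int) (P : {poly {poly int}}) : {poly {poly int}} :=
  map_poly (fun p : {poly int} => p \Po ('X + c%:P)) P.

(* Main.v *)
(** Write [psi a n x = e^(-x^2/2) x^(1/2+a) L_n^(a)(x^2)], so that psi_+ has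
    [a = beta] and psi_- has [a = -beta].  Increasing [r] by one replaces [m] by
    [(m_1 + 1, ..., m_r + 1, 0)], which inserts the nowhere vanishing seed
    [psi a 0] with [a = beta] in the Wronskian; increasing [s] inserts
    the seed [psi a 0] with [a = -beta].  By Crum's formula the
    seed can be removed at the price of applying
    [f |-> psi a 0 * (f / psi a 0)'] to the other columns, and the Laguerre
    identities show that this sends [psi a (n+1)] to [2(n+1) psi (a+1) n] and
    [psi (-a) n] to [2(n-a) psi (-a-1) n].  With [v = 2n + a] the level of
    [psi a n], the factor is in both cases the difference of levels [v - a], and
    all levels drop by one: these are exactly the factors lost by the
    Vandermonde product [kappa].  Hence the normalised Wronskian is unchanged
    when [beta] is shifted by one, for every non-integer [beta] (where [kappa]
    does not vanish), and this determines the polynomial. *)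

Require Import Defs.
From HB Require Import structures.
From mathcomp Require Import all_boot all_order all_algebra.
From mathcomp Require Import all_classical all_reals all_analysis.
From mathcomp Require Import ring lra zify.
Import Order.TTheory GRing.Theory Num.Theory.
Import numFieldNormedType.Exports.
Local Open Scope ring_scope.
Set Implicit Arguments. Unset Strict Implicit. Unset Printing Implicit Defensive.

(** * Derivatives and Wronskians of functions smooth on the positive half-line *)

Section SmoothPos.
Variable R : realType.
Implicit Types f g h phi : R -> R.
Implicit Types x y : R.

(** Only positive arguments matter, since real powers of [x] are smooth there. The half-line being
    open, identities on it may be differentiated. *)
Definition smooth_pos f :=
  forall n x, 0 < x -> derivable (derive1n n f) x 1.

Lemma near_eq_pos f g x : (forall y, 0 < y -> f y = g y) -> 0 < x ->
  \forall y \near x, f y = g y.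
Proof. by move=> fg x0; near do apply: fg; exact: lt_nbhsr. Unshelve. all: end_near. Qed.

Lemma derive1n_eq_pos f g : (forall y, 0 < y -> f y = g y) ->
  forall n x, 0 < x -> derive1n n f x = derive1n n g x.
Proof.
move=> fg; elim=> [|n IHn] x x0; first exact: fg.
by rewrite !derive1nS !derive1E; apply: near_eq_derive; exact: near_eq_pos.
Qed.

Lemma smooth_pos_eq f g : (forall y, 0 < y -> f y = g y) ->
  smooth_pos f -> smooth_pos g.
Proof.
move=> fg sf n x x0; apply: near_eq_derivable (sf n x x0).
by apply: near_eq_pos => // y; exact: derive1n_eq_pos.
Qed.

Lemma is_derive_smooth_pos f n x : smooth_pos f -> 0 < x ->
  is_derive x 1 (derive1n n f) (derive1n n.+1 f x).
Proof.
move=> sf x0; rewrite derive1nS derive1E.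
by apply: DeriveDef; first exact: sf.
Qed.

Lemma derive1n_leibniz f g n x : smooth_pos f -> smooth_pos g -> 0 < x ->
  derive1n n (fun y => f y * g y) x =
  \sum_(k < n.+1) 'C(n, k)%:R * derive1n (n - k) f x * derive1n k g x.
Proof.
move=> sf sg; elim: n x => [|n IHn] x x0.
  by rewrite big_ord_recl big_ord0 addr0 bin0 mul1r.
pose h (k : 'I_n.+1) : R -> R :=
  'C(n, k)%:R *: (derive1n (n - k) f * derive1n k g).
have hD (k : 'I_n.+1) : is_derive x 1 (h k)
    ('C(n, k)%:R * (derive1n (n - k) f x * derive1n k.+1 g x
                   + derive1n k g x * derive1n (n - k).+1 f x)).
  by apply: is_deriveZ; apply: is_deriveM; exact: is_derive_smooth_pos.
rewrite derive1nS derive1E.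
have -> : 'D_1 (derive1n n (fun y => f y * g y)) x = 'D_1 (\sum_(k < n.+1) h k) x.
  apply: near_eq_derive; apply: near_eq_pos => // y y0.
  rewrite IHn // fct_sumE; apply: eq_bigr => k _.
  by rewrite /h /= -mulrA.
have /@derive_val -> := is_derive_sum hD.
rewrite [RHS]big_ord_recl /= bin0 ?subn0 mul1r.
under eq_bigr do rewrite mulrDr.
rewrite big_split /= addrC.
rewrite [X in X + _]big_ord_recl /= bin0 ?subn0 mul1r.
rewrite -addrA; congr (_ + _); first by rewrite mulrC.
transitivity (\sum_(k < n.+1) ('C(n, k.+1)%:R + 'C(n, k)%:R) *
   derive1n (n - k) f x * derive1n k.+1 g x); last first.
  by apply: eq_bigr => k _; rewrite /bump /= add1n binS natrD subSS.
under [RHS]eq_bigr do rewrite mulrDl mulrDl.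
rewrite big_split /=; congr (_ + _); last by apply: eq_bigr => k _; rewrite mulrA.
rewrite big_ord_recr /= bin_small // !mul0r addr0.
apply: eq_bigr => k _; rewrite /bump /= add1n.
by rewrite -(subnSK (ltn_ord k)) -mulrA; congr (_ * _); rewrite mulrC.
Qed.

Definition wronskian_nat (N : nat) (F : nat -> R -> R) (x : R) : R :=
  \det (\matrix_(i < N, j < N) derive1n i (F j) x).

Lemma wronskian_nat_eq N F G x : 0 < x ->
  (forall j, (j < N)%N -> forall y, 0 < y -> F j y = G j y) ->
  wronskian_nat N F x = wronskian_nat N G x.
Proof.
move=> x0 FG; congr (\det _); apply/matrixP => i j; rewrite !mxE.
by apply: derive1n_eq_pos => // y; exact: FG.
Qed.

(** By the Leibniz rule the Wronskian matrix is that of [H] multiplied on the left by a lower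
    triangular matrix with [phi x] along the diagonal. *)
Lemma wronskian_nat_mul N phi H x : 0 < x -> smooth_pos phi ->
  (forall j, (j < N)%N -> smooth_pos (H j)) ->
  wronskian_nat N (fun j y => phi y * H j y) x = phi x ^+ N * wronskian_nat N H x.
Proof.
move=> x0 sphi sH.
pose L := \matrix_(i < N, k < N) ('C(i, k)%:R * derive1n (i - k) phi x).
have -> : phi x ^+ N = \det L.
  rewrite det_trig; last first.
    by apply/is_trig_mxP => i k ik; rewrite mxE bin_small // mul0r.
  under eq_bigr do rewrite mxE binn subnn mul1r.
  by rewrite prodr_const card_ord.
rewrite -det_mulmx; congr (\det _); apply/matrixP => i j; rewrite !mxE.
rewrite (derive1n_leibniz _ sphi) //; last exact: sH.
under [RHS]eq_bigr do rewrite !mxE.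
rewrite (big_ord_widen N (fun k => 'C(i, k)%:R * derive1n (i - k) phi x * derive1n k (H j) x)) //.
rewrite big_mkcond; apply: eq_bigr => k _; rewrite ltnS.
by case: leqP => // ik; rewrite bin_small // !mul0r.
Qed.

Lemma derive1n_scale f c n x : smooth_pos f -> 0 < x ->
  derive1n n (fun y => c * f y) x = c * derive1n n f x.
Proof.
move=> sf; elim: n x => // n IHn x x0.
rewrite !derive1nS !derive1E.
transitivity ('D_1 (c *: derive1n n f) x); last by rewrite deriveZ //; exact: sf.
by apply: near_eq_derive; exact: near_eq_pos.
Qed.

Lemma wronskian_nat_scale N c G x : 0 < x ->
  (forall j, (j < N)%N -> smooth_pos (G j)) ->
  wronskian_nat N (fun j y => c j * G j y) x =
  (\prod_(j < N) c j) * wronskian_nat N G x.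
Proof.
move=> x0 sG.
pose D := diag_mx (\row_(j < N) c j).
have -> : \prod_(j < N) c j = \det D.
  by rewrite det_diag; apply: eq_bigr => j _; rewrite mxE.
rewrite mulrC -det_mulmx; congr (\det _); apply/matrixP => i j.
rewrite mul_mx_diag !mxE mulrC derive1n_scale //; exact: sG.
Qed.

Lemma derive1n_cst (c : R) n x : derive1n n.+1 (fun=> c) x = 0.
Proof.
elim: n x => [|n IHn] x; first by rewrite derive1n1 derive1_cst.
by rewrite derive1nS (_ : derive1n n.+1 _ = fun=> 0) ?derive1_cst//; apply/funext.
Qed.

(** The column of the constant 1 is the first unit vector, so a single cofactor survives and
    supplies the sign. *)
Lemma wronskian_nat_one N (j0 : 'I_N.+1) (H : nat -> R -> R) x : 0 < x ->
  (forall y, 0 < y -> H j0 y = 1) ->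
  wronskian_nat N.+1 H x =
  (-1) ^+ j0 * wronskian_nat N (fun j => derive1 (H (bump j0 j))) x.
Proof.
move=> x0 H1; rewrite /wronskian_nat (expand_det_col _ j0) big_ord_recl big1.
  rewrite addr0 !mxE /= H1 // mul1r /cofactor add0n; congr (_ * \det _).
  by apply/matrixP => i j; rewrite !mxE -derive1Sn.
move=> i _; rewrite mxE (derive1n_eq_pos H1) // derive1n_cst mul0r //.
Qed.

(* Crum's formula: dividing all columns by [phi] turns column [j0] into the
   constant 1, and expanding along it leaves a Wronskian of derivatives. *)
Lemma wronskian_nat_crum N (j0 : 'I_N.+1) (F G : nat -> R -> R) (c : nat -> R) x :
  0 < x ->
  smooth_pos (F j0) -> (forall y, 0 < y -> F j0 y != 0) ->
  (forall j, (j < N.+1)%N -> smooth_pos (fun y => F j y / F j0 y)) ->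
  (forall j, (j < N)%N -> smooth_pos (fun y => G j y / F j0 y)) ->
  (forall j, (j < N)%N -> forall y, 0 < y ->
     derive1 (fun y => F (bump j0 j) y / F j0 y) y = c j * (G j y / F j0 y)) ->
  wronskian_nat N.+1 F x =
  (-1) ^+ j0 * (\prod_(j < N) c j) * F j0 x * wronskian_nat N G x.
Proof.
move=> x0 sphi phi0 sH sK HK.
set phi := F j0 in sphi phi0 sH sK HK *.
have FE j : (j < N.+1)%N -> forall y, 0 < y -> F j y = phi y * (F j y / phi y).
  by move=> _ y y0; rewrite mulrC divfK ?phi0.
have GE j : (j < N)%N -> forall y, 0 < y -> G j y = phi y * (G j y / phi y).
  by move=> _ y y0; rewrite mulrC divfK ?phi0.
(* The left side yields [phi x ^+ N.+1] and the right side only [phi x ^+ N]; the difference is the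
   single factor [F j0 x] of the claim. *)
rewrite (wronskian_nat_eq x0 FE) (wronskian_nat_mul x0 sphi) //.
rewrite (wronskian_nat_eq x0 GE) (wronskian_nat_mul x0 sphi) //.
rewrite (wronskian_nat_one (j0 := j0)) //; last by move=> y y0; rewrite divff ?phi0.
rewrite (wronskian_nat_eq x0 HK) wronskian_nat_scale // exprS; ring.
Qed.

End SmoothPos.

(** * Laguerre identities and derivatives of quotients by a seed *)

Section Laguerre.
Variable R : realType.
Implicit Types (a b c x y : R) (q : {poly R}).

(** A family closed under differentiation, whence its smoothness. It contains [psi] (with [c] equal
    to -1/2) and its quotients by a seed (with [c] equal to 0). *)
Definition gauss_pow c a q x : R := expR (c * x ^+ 2) * x `^ a * q.[x].

Lemma powRS_pos x a : 0 < x -> x `^ a = x * x `^ (a - 1).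
Proof.
move=> x0; rewrite -{2}[x]powRr1 ?ltW// -powRD; last by rewrite (gt_eqF x0) implybT.
by congr (_ `^ _); ring.
Qed.

Lemma is_derive_gauss_pow c a q x : 0 < x ->
  is_derive x 1 (gauss_pow c a q)
    (gauss_pow c (a - 1) (a *: q + 'X * q^`() + (2 * c) *: ('X^2 * q)) x).
Proof.
move=> x0.
have dE : is_derive x 1 (fun y : R => expR (c * y ^+ 2))
    (expR (c * x ^+ 2) * (2 * c * x)).
  have -> : (fun y : R => expR (c * y ^+ 2)) = expR \o horner (c *: 'X^2).
    by apply/funext => y; rewrite /= !hornerE.
  apply: is_derive_eq; rewrite derivZ derivXn !hornerE /=.
  ring.
have dP := is_derive1_powR a x0.
have dEP := is_deriveM dE dP.
apply: (is_derive_eq (is_deriveM dEP (is_derive_poly q x))).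
rewrite /gauss_pow; set e := expR _.
rewrite fctE -/e /GRing.scale /= (powRS_pos a x0) !hornerE /=.
ring.
Qed.

Lemma smooth_pos_gauss_pow c a q : smooth_pos (gauss_pow c a q).
Proof.
have H n : exists a' q', forall y, 0 < y ->
    derive1n n (gauss_pow c a q) y = gauss_pow c a' q' y.
  elim: n => [|n [a' [q' IHn]]]; first by exists a, q.
  exists (a' - 1), (a' *: q' + 'X * q'^`() + (2 * c) *: ('X^2 * q')) => y y0.
  rewrite derive1nS -derive1n1.
  rewrite (derive1n_eq_pos IHn) // derive1n1 derive1E.
  by have /@derive_val := is_derive_gauss_pow c a' q' y0.
move=> n x x0; have [a' [q' E]] := H n.
apply: near_eq_derivable.
  by apply: near_eq_pos x0 => y y0; symmetry; exact: E.
by have /@ex_derive := is_derive_gauss_pow c a' q' x0.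
Qed.

Definition laguerre_poly n a : {poly R} :=
  \poly_(i < n.+1) ((-1) ^+ (n + i) * 'C(n, i)%:R * rising (a + i%:R + 1) (n - i)).

Lemma laguerre_hatE n a y : laguerre_hat n a y = (laguerre_poly n a).[y].
Proof. by rewrite horner_poly. Qed.

Lemma laguerre_poly0 a : laguerre_poly 0 a = 1.
Proof.
apply/polyP => -[|i]; rewrite coef_poly ?coef1 //=.
by rewrite /rising big_ord0 !mulr1.
Qed.

(** Coefficientwise this is (n+1) C(n,i) = (i+1) C(n+1,i+1); the rising factorials on the two sides
    coincide. *)
Lemma deriv_laguerre_poly n a :
  (laguerre_poly n.+1 a)^`() = n.+1%:R *: laguerre_poly n (a + 1).
Proof.
apply/polyP => i; rewrite coef_deriv coefZ !coef_poly ltnS.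
case: ltnP => [lin|_]; last by rewrite mul0rn mulr0.
rewrite subSS addSn addnS !exprS -mulr_natr.
have -> : a + 1 + i%:R + 1 = a + i.+1%:R + 1 by rewrite -natr1; ring.
have := mul_bin_diag n.+1 i; rewrite /= => /(congr1 (fun k => k%:R : R)).
rewrite !natrM => E.
transitivity ((-1) ^+ (n + i) * (i.+1%:R * 'C(n.+1, i.+1)%:R)
    * rising (a + i.+1%:R + 1) (n - i)); first by ring.
by rewrite -E; ring.
Qed.

(** The operator y d/dy + a multiplies the coefficient of y^i by i + a, and this factor extends the
    rising factorial downwards: (a+i) (a+i+1)_(n-i) = (n+a) (a+i)_(n-i). *)
Lemma laguerre_poly_lower n a :
  'X * (laguerre_poly n a)^`() + a *: laguerre_poly n a =
  (n%:R + a) *: laguerre_poly n (a - 1).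
Proof.
apply/polyP => i.
have -> : ('X * (laguerre_poly n a)^`() + a *: laguerre_poly n a)`_i
   = (i%:R + a) * (laguerre_poly n a)`_i.
  rewrite coefD coefZ coefXM; case: i => [|i] /=; first ring.
  by rewrite coef_deriv -mulr_natl; ring.
rewrite coefZ !coef_poly.
case: ltnP => [lin|_]; last by rewrite !mulr0.
(* Both sides are the product of z + j over j from 0 to m, with the first or the last factor split
   off. *)
have rE (z : R) m : z * rising (z + 1) m = (z + m%:R) * rising z m.
  rewrite /rising mulrC [in RHS]mulrC.
  transitivity (\prod_(j < m.+1) (z + j%:R)); last by rewrite big_ord_recr.
  rewrite big_ord_recl addr0 mulrC; congr (_ * _).
  by apply: eq_bigr => j _; rewrite /bump /= natrD addrA.
have := rE (a + i%:R) (n - i)%N.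
rewrite natrB // => E.
have -> : a - 1 + i%:R + 1 = a + i%:R by ring.
transitivity ((-1) ^+ (n + i) * 'C(n, i)%:R *
   ((a + i%:R) * rising (a + i%:R + 1) (n - i))); first ring.
rewrite E; ring.
Qed.

(* [psi_plus b] is [psi b] and [psi_minus b] is [psi (- b)]. *)
Definition psi a n x : R :=
  expR (- (x ^+ 2) / 2) * x `^ (2^-1 + a) * laguerre_hat n a (x ^+ 2).

Lemma psiE a n x :
  psi a n x = gauss_pow (- 2^-1) (2^-1 + a) (laguerre_poly n a \Po 'X^2) x.
Proof.
rewrite /psi /gauss_pow horner_comp hornerXn laguerre_hatE.
by congr (expR _ * _ * _); field.
Qed.

Lemma smooth_pos_psi a n : smooth_pos (psi a n).
Proof.
move: (@smooth_pos_gauss_pow (- 2^-1) (2^-1 + a) (laguerre_poly n a \Po 'X^2)).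
by apply: smooth_pos_eq => y _; rewrite psiE.
Qed.

Lemma psi0E a x : psi a 0 x = expR (- (x ^+ 2) / 2) * x `^ (2^-1 + a).
Proof. by rewrite /psi laguerre_hatE laguerre_poly0 hornerC mulr1. Qed.

Lemma psi0_neq0 a x : 0 < x -> psi a 0 x != 0.
Proof. by move=> x0; rewrite psi0E mulf_neq0 // gt_eqF ?expR_gt0 ?powR_gt0. Qed.

Lemma psi_div a n b x : 0 < x ->
  psi a n x / psi b 0 x = gauss_pow 0 (a - b) (laguerre_poly n a \Po 'X^2) x.
Proof.
move=> x0; rewrite psi0E /psi /gauss_pow horner_comp hornerXn laguerre_hatE.
have e0 : expR (- x ^+ 2 / 2) != 0 by rewrite gt_eqF ?expR_gt0.
have p0 : x `^ (2^-1 + b) != 0 by rewrite gt_eqF ?powR_gt0.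
have -> : a - b = (2^-1 + a) - (2^-1 + b) by ring.
rewrite powRB ?(gt_eqF x0) ?implybT // mul0r expR0.
by field; rewrite e0 p0.
Qed.

Lemma smooth_pos_psi_div a n b : smooth_pos (fun x => psi a n x / psi b 0 x).
Proof.
move: (@smooth_pos_gauss_pow 0 (a - b) (laguerre_poly n a \Po 'X^2)).
by apply: smooth_pos_eq => y y0; rewrite psi_div.
Qed.

(** The Gaussians cancel in the quotient, leaving x^(a-b) times a polynomial in x^2; the chain rule
    gives the factor 2. *)
Lemma derive1_psi_div a n b x : 0 < x ->
  derive1 (fun y => psi a n y / psi b 0 y) x =
  x `^ (a - b - 1) * (((a - b) *: laguerre_poly n a
     + 2 *: ('X * (laguerre_poly n a)^`())).[x ^+ 2]).
Proof.
move=> x0; rewrite -derive1n1 (derive1n_eq_pos (@psi_div a n b)) // derive1n1 derive1E.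
have /@derive_val -> := is_derive_gauss_pow 0 (a - b) (laguerre_poly n a \Po 'X^2) x0.
rewrite /gauss_pow mul0r expR0 mul1r deriv_comp derivXn !(hornerE, horner_comp) /=.
ring.
Qed.

(** With equal exponents the powers of [x] cancel, so only the polynomial is differentiated. The
    scalar keeps [+ a - a] so as to read as a level minus [a]. *)
Lemma derive1_psi_raise a n x : 0 < x ->
  derive1 (fun y => psi a n.+1 y / psi a 0 y) x =
  (2 * n.+1%:R + a - a) * (psi (a + 1) n x / psi a 0 x).
Proof.
move=> x0; rewrite derive1_psi_div // psi_div // /gauss_pow deriv_laguerre_poly.
rewrite subrr scale0r !add0r mul0r expR0 mul1r !hornerZ hornerM hornerX hornerZ horner_comp hornerXn.
have -> : a + 1 - a = 1 by ring.
rewrite powRr1 ?ltW // powR_inv1 ?ltW //.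
by field; rewrite gt_eqF.
Qed.

(** The bracket from the chain rule is twice the operator of [laguerre_poly_lower] at parameter
    [- a]. *)
Lemma derive1_psi_lower a n x : 0 < x ->
  derive1 (fun y => psi (- a) n y / psi a 0 y) x =
  (2 * n%:R - a - a) * (psi (- (a + 1)) n x / psi a 0 x).
Proof.
move=> x0; rewrite derive1_psi_div // psi_div // /gauss_pow.
have -> : (- a - a) *: laguerre_poly n (- a) + 2 *: ('X * (laguerre_poly n (- a))^`())
  = 2 *: ((n%:R - a) *: laguerre_poly n (- a - 1)).
  rewrite -laguerre_poly_lower scalerDr addrC; congr (_ + _).
  by rewrite scalerA; congr (_ *: _); ring.
have -> : - (a + 1) - a = - a - a - 1 by ring.
have -> : - (a + 1) = - a - 1 by ring.
rewrite mul0r expR0 mul1r horner_comp hornerXn !hornerZ.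
ring.
Qed.

End Laguerre.

(** * One Darboux step, on the Wronskian and on the Vandermonde product *)

Section CrumStep.
Variable R : realType.
Implicit Types (a b x : R) (p : R * nat) (S : seq (R * nat)) (m n : seq nat).

Definition vandermonde_nat N (v : nat -> R) : R :=
  \prod_(j < N) \prod_(i < N | (i < j)%N) (v j - v i).

Lemma ltn_bump h i j : (bump h i < bump h j)%N = (i < j)%N.
Proof. by rewrite !ltnNge leq_bump2. Qed.

(** The pairs involving [j0] are split off. Those with a smaller index occur as [v j0 - v j], and
    reversing them costs the same sign as the cofactor in Crum's formula. *)
Lemma vandermonde_nat_step N (j0 : 'I_N.+1) v :
  vandermonde_nat N.+1 v =
  (-1) ^+ j0 * (\prod_(j < N) (v (bump j0 j) - v j0))
  * vandermonde_nat N (fun j => v (bump j0 j)).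
Proof.
rewrite /vandermonde_nat (bigD1_ord j0) //=.
have E (j : 'I_N) : \prod_(i < N.+1 | (i < bump j0 j)%N) (v (bump j0 j) - v i) =
   (if (j0 <= j)%N then v (bump j0 j) - v j0 else 1)
   * \prod_(i < N | (i < j)%N) (v (bump j0 j) - v (bump j0 i)).
  rewrite big_mkcond (bigD1_ord j0) //=; congr (_ * _).
    by rewrite /bump; case: (leqP j0 j) => /= h; case: ltnP => //; lia.
  by rewrite -big_mkcond; apply: eq_bigl => i; rewrite ltn_bump.
under [X in _ * X]eq_bigr do rewrite E.
rewrite big_split /= mulrA; congr (_ * _).
(* Spreading the sign over the indices below [j0] reduces the claim to one factor at a time. *)
have -> : (-1) ^+ j0 = \prod_(j < N) (if (j < j0)%N then -1 else 1) :> R.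
  rewrite -big_mkcond -(big_ord_widen N (fun=> -1)) ?prodr_const ?card_ord //.
  by rewrite -ltnS.
rewrite big_mkcond (bigD1_ord j0) //= ltnn mul1r.
rewrite (eq_bigr (fun j : 'I_N => if (j < j0)%N then v j0 - v (bump j0 j) else 1)) //.
  rewrite -!big_split /=; apply: eq_bigr => j _.
  by case: leqP => _; ring.
move=> j _; congr (if _ then _ else _).
by rewrite /bump; case: (leqP j0 j) => /= h; lia.
Qed.

Definition wronskian_psi S x : R := wronskian [seq psi p.1 p.2 | p <- S] x.

(* The entries of the Vandermonde product [kappa]. *)
Definition psi_level p : R := 2 * p.2%:R + p.1.

Definition vandermonde_psi S : R := vandermonde [seq psi_level p | p <- S].

Lemma wronskian_psiE p0 S x : 0 < x ->
  wronskian_psi S x =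
  wronskian_nat (size S) (fun j => psi (nth p0 S j).1 (nth p0 S j).2) x.
Proof.
move=> x0; rewrite /wronskian_psi.
rewrite -[LHS]/(wronskian_nat (size (map _ S)) (nth (fun=> 0) (map _ S)) x) size_map.
by apply: wronskian_nat_eq => // j jS y _; rewrite (nth_map p0).
Qed.

Lemma vandermonde_psiE p0 S :
  vandermonde_psi S = vandermonde_nat (size S) (fun j => psi_level (nth p0 S j)).
Proof.
rewrite /vandermonde_psi /vandermonde size_map.
apply: eq_bigr => j _; apply: eq_bigr => i _.
by rewrite !(nth_map p0).
Qed.

Lemma nth_cat_bump (T : Type) (z c : T) (s1 s2 : seq T) j :
  nth z (s1 ++ c :: s2) (bump (size s1) j) = nth z (s1 ++ s2) j.
Proof.
rewrite !nth_cat /bump; case: (ltnP j (size s1)) => h.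
  by rewrite add0n h.
by rewrite add1n ltnNge (leqW h) /= subSn.
Qed.

(* The pairs (eigenfunction, image) under the Darboux transformation with seed
   [psi a 0]. *)
Definition darboux a (q : (R * nat) * (R * nat)) : Prop :=
  exists k, q = ((a, k.+1), (a + 1, k)) \/ q = ((- a, k), (- (a + 1), k)).

Lemma darboux_level a q : darboux a q -> psi_level q.2 = psi_level q.1 - 1.
Proof. by case=> k [] ->; rewrite /psi_level /= -?natr1; ring. Qed.

Lemma derive1_darboux a q x : darboux a q -> 0 < x ->
  derive1 (fun y => psi q.1.1 q.1.2 y / psi a 0 y) x =
  (psi_level q.1 - a) * (psi q.2.1 q.2.2 x / psi a 0 x).
Proof.
by case=> k [] -> x0 /=; rewrite ?derive1_psi_raise ?derive1_psi_lower.
Qed.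

(** What matters is that the same [C] serves both identities: it then cancels in the quotient of the
    Wronskian by the Vandermonde product. [L1] and [L2] are the columns before and after the
    seed. *)
Lemma crum_step a (L1 L2 : seq ((R * nat) * (R * nat))) x : 0 < x ->
  (forall q, q \in L1 ++ L2 -> darboux a q) ->
  let S := map fst L1 ++ (a, 0%N) :: map fst L2 in
  let S' := map snd (L1 ++ L2) in
  exists2 C, wronskian_psi S x = C * psi a 0 x * wronskian_psi S' x
           & vandermonde_psi S = C * vandermonde_psi S'.
Proof.
move=> x0; set L := L1 ++ L2 => dL S S'.
have szS : size S = (size L).+1 by rewrite !size_cat /= !size_map addnS.
have j0P : (size L1 < (size L).+1)%N by rewrite ltnS size_cat leq_addr.
pose j0 := Ordinal j0P; pose p0 : R * nat := (0, 0%N).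
have Sj0 : nth p0 S j0 = (a, 0%N) by rewrite nth_cat size_map ltnn subnn.
have Sbump j : (j < size L)%N -> nth p0 S (bump j0 j) = (nth (p0, p0) L j).1.
  move=> jL; rewrite /S /= -(size_map fst L1) nth_cat_bump -map_cat.
  by rewrite (nth_map (p0, p0)).
have S'E j : (j < size L)%N -> nth p0 S' j = (nth (p0, p0) L j).2.
  by move=> jL; rewrite (nth_map (p0, p0)).
have dj j : (j < size L)%N -> darboux a (nth (p0, p0) L j).
  by move=> jL; apply: dL; rewrite mem_nth.
exists ((-1) ^+ j0 * \prod_(j < size L) (psi_level (nth (p0, p0) L j).1 - a)).
  rewrite !(wronskian_psiE p0) // szS size_map.
  rewrite (@wronskian_nat_crum _ _ j0 _ (fun j => psi (nth p0 S' j).1 (nth p0 S' j).2)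
    (fun j => psi_level (nth (p0, p0) L j).1 - a)) //=; rewrite Sj0 //=.
  - exact: smooth_pos_psi.
  - by move=> y; exact: psi0_neq0.
  - by move=> j _; exact: smooth_pos_psi_div.
  - by move=> j _; exact: smooth_pos_psi_div.
  - move=> j jL y y0; rewrite Sbump // S'E //; exact: derive1_darboux (dj _ jL) y0.
rewrite !(vandermonde_psiE p0) szS size_map (vandermonde_nat_step j0) Sj0.
congr (_ * _ * _).
  by apply: eq_bigr => j _; rewrite Sbump // [psi_level (a, _)]/psi_level mulr0 add0r.
apply: eq_bigr => j _; apply: eq_bigr => i _.
(* All levels drop by one, so their differences do not change. *)
rewrite !Sbump // !S'E // !(darboux_level (dj _ (ltn_ord _))); ring.
Qed.

End CrumStep.

(** * The normalised Wronskian and its invariance *)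

Section PhiValue.
Variable R : realType.
Implicit Types (b x y : R) (m n lam mu : seq nat) (r s : nat).

Definition psi_config b m n : seq (R * nat) :=
  [seq (b, k) | k <- m] ++ [seq (- b, k) | k <- n].

Lemma PsiE b m n x : Psi b m n x = wronskian_psi (psi_config b m n) x.
Proof. by rewrite /wronskian_psi /psi_config map_cat -!map_comp. Qed.

Lemma kappaE b m n : kappa b m n = vandermonde_psi (psi_config b m n).
Proof. by rewrite /vandermonde_psi /psi_config map_cat -!map_comp. Qed.

Lemma intr_natB (k l : nat) : (k%:Z - l%:Z)%:~R = k%:R - l%:R :> R.
Proof. by rewrite rmorphB /= -!pmulrn. Qed.

Definition prefactor b m n x : R :=
  expR (- ((size m + size n)%:R * x ^+ 2) / 2)
  * x `^ ((((size m)%:Z - (size n)%:Z) ^+ 2)%:~R / 2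
          + b * ((size m)%:Z - (size n)%:Z)%:~R).

Lemma prefactor_neq0 b m n x : 0 < x -> prefactor b m n x != 0.
Proof. by move=> x0; rewrite mulf_neq0 // gt_eqF ?expR_gt0 ?powR_gt0. Qed.

(* Junk (zero) when [kappa b m n = 0], i.e. for some integers [b]. *)
Definition Phi_value b m n x : R :=
  Psi b m n x / (kappa b m n * prefactor b m n x).

(* [lam + delta_(r+1)] is [shift0 (lam + delta_r)] once [r >= ell(lam)]. *)
Definition shift0 m := [seq k.+1 | k <- m] ++ [:: 0%N].

Lemma size_shift0 m : size (shift0 m) = (size m).+1.
Proof. by rewrite size_cat size_map addn1. Qed.

(** With d the difference of the sizes, the exponents match because (d+1)^2/2 + b(d+1) = (1/2 + b) +
    d^2/2 + (b+1)d. *)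
Lemma prefactor_shift0l b m n x : 0 < x ->
  prefactor b (shift0 m) n x = psi b 0 x * prefactor (b + 1) m n x.
Proof.
move=> x0; rewrite /prefactor psi0E size_shift0 mulrACA -expRD -powRD; last first.
  by rewrite (gt_eqF x0) implybT.
rewrite !rmorphXn /= !intr_natB.
by congr (expR _ * _ `^ _); rewrite ?natrD -?natr1; field.
Qed.

Lemma prefactor_shift0r b m n x : 0 < x ->
  prefactor b m (shift0 n) x = psi (- b) 0 x * prefactor (b - 1) m n x.
Proof.
move=> x0; rewrite /prefactor psi0E size_shift0 mulrACA -expRD -powRD; last first.
  by rewrite (gt_eqF x0) implybT.
rewrite !rmorphXn /= !intr_natB.
by congr (expR _ * _ `^ _); rewrite ?natrD -?natr1; field.
Qed.

(** Cancellation of [C] and [phi]; that [C] and the second [kappa] are nonzero follows from the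
    factorisation of the first. *)
Lemma Phi_value_step b b' m n m' n' C phi x :
  kappa b m n != 0 -> phi != 0 -> prefactor b' m' n' x != 0 ->
  Psi b m n x = C * phi * Psi b' m' n' x ->
  kappa b m n = C * kappa b' m' n' ->
  prefactor b m n x = phi * prefactor b' m' n' x ->
  Phi_value b m n x = Phi_value b' m' n' x.
Proof.
rewrite /Phi_value => k0 phi0 p0 -> kE ->; move: k0; rewrite kE mulf_eq0 negb_or.
by case/andP => C0 k0; field; rewrite C0 k0 phi0 p0.
Qed.

Lemma Phi_value_shift0l b m n x : 0 < x -> kappa b (shift0 m) n != 0 ->
  Phi_value b (shift0 m) n x = Phi_value (b + 1) m n x.
Proof.
move=> x0 k0.
pose L1 := [seq ((b, k.+1), (b + 1, k)) | k <- m].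
pose L2 := [seq ((- b, k), (- (b + 1), k)) | k <- n].
have dL q : q \in L1 ++ L2 -> darboux b q.
  by rewrite mem_cat => /orP[] /mapP[k _ ->]; exists k; [left|right].
have [C] := crum_step x0 dL.
rewrite map_cat -!map_comp /= -/(psi_config (b + 1) m n).
have <- : psi_config b (shift0 m) n =
    [seq (b, k.+1) | k <- m] ++ (b, 0%N) :: [seq (- b, k) | k <- n].
  by rewrite /psi_config /shift0 map_cat -map_comp -catA.
rewrite -!PsiE -!kappaE => PE kE.
apply: Phi_value_step PE kE _ => //; first exact: psi0_neq0.
  exact: prefactor_neq0.
exact: prefactor_shift0l.
Qed.

(** The Darboux step has parameter [- b], so the two blocks exchange roles: the second is raised,
    the first lowered. The seed is the last column, hence nothing follows it. *)
Lemma Phi_value_shift0r b m n x : 0 < x -> kappa b m (shift0 n) != 0 ->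
  Phi_value b m (shift0 n) x = Phi_value (b - 1) m n x.
Proof.
move=> x0 k0.
pose L1 := [seq ((b, k), (b - 1, k)) | k <- m] ++
           [seq ((- b, k.+1), (- (b - 1), k)) | k <- n].
have dL q : q \in L1 ++ [::] -> darboux (- b) q.
  rewrite cats0 mem_cat => /orP[] /mapP[k _ ->]; exists k; [right|left].
    by rewrite opprK opprD opprK.
  by rewrite opprB addrC.
have [C] := crum_step x0 dL.
rewrite cats0 !map_cat -!map_comp /= -/(psi_config (b - 1) m n).
have <- : psi_config b m (shift0 n) =
    ([seq (b, k) | k <- m] ++ [seq (- b, k.+1) | k <- n]) ++ [:: (- b, 0%N)].
  by rewrite /psi_config /shift0 map_cat -map_comp -catA.
rewrite -!PsiE -!kappaE => PE kE.
apply: Phi_value_step PE kE _ => //; first exact: psi0_neq0.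
  exact: prefactor_neq0.
exact: prefactor_shift0r.
Qed.

(** * Nonvanishing of [kappa], and stability in [r] and [s] *)

Lemma vandermonde_neq0 (v : seq R) : uniq v -> vandermonde v != 0.
Proof.
move=> uv; apply/prodf_neq0 => j _; apply/prodf_neq0 => i ij.
by rewrite subr_eq0 nth_uniq // gt_eqF.
Qed.

(** A coincidence between the blocks, 2l + b = 2k - b, would make b = k - l an integer. *)
Lemma kappa_neq0 b m n : b \isn't a Num.int -> uniq m -> uniq n ->
  kappa b m n != 0.
Proof.
move=> bZ um un; apply: vandermonde_neq0; rewrite cat_uniq.
have inj c : injective (fun k : nat => 2 * k%:R + c : R).
  by move=> k l /addIr /mulfI; rewrite pnatr_eq0 => /(_ isT) /eqP; rewrite eqr_nat => /eqP.
rewrite !map_inj_uniq ?um ?un //= andbT.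
apply/hasPn => _ /mapP[k _ ->]; apply/negP => /mapP[l _ E].
case/negP: bZ; have -> : b = k%:R - l%:R by lra.
by rewrite rpredB // natr_int.
Qed.

Lemma size_add_delta lam r : size (add_delta lam r) = r.
Proof. by rewrite size_map size_iota. Qed.

Lemma add_deltaS lam r : (size lam <= r)%N ->
  add_delta lam r.+1 = shift0 (add_delta lam r).
Proof.
move=> lr; rewrite /add_delta /shift0 -addn1 iotaD map_cat /= add0n.
(* Position [r] lies beyond the nonzero parts, so the default 0 makes the last entry 0. *)
rewrite nth_default // addn1 subnn -map_comp; congr (_ ++ _).
by apply/eq_in_map => i /=; rewrite mem_iota => ir; lia.
Qed.

Lemma nth_partition_le lam i j : is_partition lam -> (i <= j)%N ->
  (nth 0 lam j <= nth 0 lam i)%N.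
Proof.
case/andP=> srt _ ij; case: (ltnP j (size lam)) => jl; last by rewrite nth_default.
have gt : transitive geq by move=> a b c /= ba cb; exact: leq_trans cb ba.
apply: (sorted_leq_nth gt leqnn 0%N srt) => //.
by rewrite inE (leq_ltn_trans ij).
Qed.

Lemma uniq_add_delta lam r : is_partition lam -> uniq (add_delta lam r).
Proof.
move=> pl; rewrite map_inj_in_uniq ?iota_uniq // => i j.
rewrite !mem_iota !add0n /= => ir jr.
by case: (ltngtP i j) => // ij; have := nth_partition_le pl (ltnW ij); lia.
Qed.

Lemma kappa_add_delta_neq0 b lam mu r s :
  b \isn't a Num.int -> is_partition lam -> is_partition mu ->
  kappa (b - r%:R + s%:R) (add_delta lam r) (add_delta mu s) != 0.
Proof.
move=> bZ pl pm; apply: kappa_neq0; rewrite ?uniq_add_delta //.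
by rewrite rpredDr ?natr_int // rpredBr ?natr_int.
Qed.

(** Descent to the smallest [r], then to the smallest [s]. The offset [- r%:R + s%:R] absorbs the
    shift of the parameter by 1 or -1 at each removal. *)
Lemma Phi_value_stable b lam mu r s x :
  0 < x -> b \isn't a Num.int -> is_partition lam -> is_partition mu ->
  (size lam <= r)%N -> (size mu <= s)%N ->
  Phi_value (b - r%:R + s%:R) (add_delta lam r) (add_delta mu s) x =
  Phi_value (b - (size lam)%:R + (size mu)%:R)
    (add_delta lam (size lam)) (add_delta mu (size mu)) x.
Proof.
move=> x0 bZ pl pm lr ls.
have k0 := kappa_add_delta_neq0 _ _ bZ pl pm.
transitivity (Phi_value (b - (size lam)%:R + s%:R) (add_delta lam (size lam))
                (add_delta mu s) x).
  elim: r lr => [|r IHr]; first by rewrite leqn0 => /eqP ->.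
  rewrite leq_eqVlt => /orP[/eqP -> //|lr]; rewrite ltnS in lr.
  rewrite -(IHr lr) add_deltaS // Phi_value_shift0l -?add_deltaS //.
  by congr Phi_value; rewrite -natr1; ring.
elim: s ls => [|s IHs]; first by rewrite leqn0 => /eqP ->.
rewrite leq_eqVlt => /orP[/eqP -> //|ls]; rewrite ltnS in ls.
rewrite -(IHs ls) add_deltaS // Phi_value_shift0r -?add_deltaS //.
by congr Phi_value; rewrite -natr1; ring.
Qed.

(** * From values at non-integer parameters to polynomials *)

Lemma is_Phi_tilde_value b m n P x : 0 < x -> kappa b m n != 0 ->
  is_Phi_tilde R m n P -> eval2 P b (x ^+ 2) = Phi_value b m n x.
Proof.
move=> x0 k0 [_ /(_ b x x0) PE]; rewrite /Phi_value PE -[_ * _ * powR _ _]mulrA.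
by rewrite -/(prefactor b m n x) mulrC mulKf // mulf_neq0 // prefactor_neq0.
Qed.

Lemma eval2_shift_beta c P b y :
  eval2 (shift_beta c P) b y = eval2 P (b + c%:~R) y.
Proof.
rewrite /eval2 /shift_beta -map_poly_comp_id0; last by rewrite rmorph0 horner0.
congr (_.[y]); apply: eq_map_poly => p /=.
rewrite map_comp_poly horner_comp rmorphD /= map_polyX map_polyC.
by rewrite hornerD hornerX hornerC.
Qed.

Lemma poly_eq_of_infinite_roots (D : idomainType) (p q : {poly D}) (u : nat -> D) :
  injective u -> (forall k, p.[u k] = q.[u k]) -> p = q.
Proof.
move=> iu pq; apply/eqP; rewrite -subr_eq0; apply/negPn/negP => pq0.
have := max_poly_roots pq0 (rs := [seq u k | k <- iota 0 (size (p - q))]).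
rewrite size_map size_iota ltnn map_inj_uniq // iota_uniq => H.
apply: notF; apply: H => //.
by apply/allP => _ /mapP[k _ ->]; rewrite /root hornerD hornerN pq subrr.
Qed.

(** Interpolation twice: for each sampled [b], infinitely many squares determine the polynomial in
    y; then each coefficient is determined by infinitely many [b]. *)
Lemma eval2_inj (P Q : {poly {poly int}}) :
  (forall b x, b \isn't a Num.int -> 0 < x -> eval2 P b (x ^+ 2) = eval2 Q b (x ^+ 2)) ->
  P = Q.
Proof.
move=> PQ; apply/polyP => i.
apply: (map_inj_poly (f := intr : int -> R)); [exact: intr_inj | by [] |].
(* The [u k] lie strictly between 0 and 1, hence are not integers; the [v k] are squares of positive
   numbers. *)
pose u k : R := k.+2%:R^-1; pose v k : R := k.+1%:R ^+ 2.
have u_inj : injective u.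
  by move=> k l /invr_inj /eqP; rewrite eqr_nat => /eqP [].
have v_inj : injective v.
  move=> k l /eqP; rewrite eqrXn2 // => /eqP E.
  by have /eqP := E; rewrite eqr_nat => /eqP [].
have uZ k : u k \isn't a Num.int.
  have u0 : 0 < u k by rewrite invr_gt0.
  have u1 : u k < 1 by rewrite invf_lt1 // ltr1n.
  apply/negP => /intrP[z zE]; move: u0 u1; rewrite zE ltr0z ltrz1; lia.
apply: (poly_eq_of_infinite_roots u_inj) => k.
have /(congr1 (fun p : {poly R} => p`_i)) :
    map_poly (fun c : {poly int} => (map_poly intr c).[u k]) P =
    map_poly (fun c : {poly int} => (map_poly intr c).[u k]) Q.
  by apply: (poly_eq_of_infinite_roots v_inj) => j; exact: PQ.
by rewrite !coef_map_id0 ?rmorph0 ?horner0.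
Qed.

End PhiValue.

Theorem theorem2p5 (R : realType) (lam mu : seq nat)
    (r s r' s' : nat) (P Q : {poly {poly int}}) :
  is_partition lam -> is_partition mu ->
  (size lam <= r)%N -> (size mu <= s)%N ->
  (size lam <= r')%N -> (size mu <= s')%N ->
  is_Phi_tilde R (add_delta lam r) (add_delta mu s) P ->
  is_Phi_tilde R (add_delta lam r') (add_delta mu s') Q ->
  shift_beta (s%:Z - r%:Z) P = shift_beta (s'%:Z - r'%:Z) Q.
Proof.
move=> pl pm lr ms lr' ms' HP HQ.
apply: (@eval2_inj R) => b x bZ x0; rewrite !eval2_shift_beta.
have shiftE (i j : nat) : b + (j%:Z - i%:Z)%:~R = b - i%:R + j%:R :> R.
  by rewrite intr_natB; ring.
have k0 := kappa_add_delta_neq0 _ _ bZ pl pm.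
(* Both sides become normalised Wronskians, each equal to the one for [r] and [s] minimal. *)
rewrite !shiftE (is_Phi_tilde_value x0 (k0 r s) HP) (is_Phi_tilde_value x0 (k0 r' s') HQ).
by rewrite !Phi_value_stable.
Qed.
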